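(* Let $Y=\{0,1\}^{\mathbb{Z}}$ be the full $2$-shift, let $X$ and $Z$ be the subshifts described in the context, and let $W=X\times Y\times Z$ with the product shift $\sigma$. Then the automorphism group $\mathrm{Aut}(W)$ of $(W,\sigma)$ is not amenable as a countable discrete group.
   Context: A subshift is a closed nonempty subset of $\mathcal{A}^{\mathbb{Z}}$ ($\mathcal{A}$ finite) invariant under the left shift $\sigma$; it is minimal if it has no nonempty proper subshift. Products of subshifts carry the product shift and are subshifts over the product alphabet. $\mathrm{Aut}(W)$ is the group of homeomorphisms of $W$ commuting with $\sigma$. $\mathcal{L}(X)$ is the set of finite words occurring in elements of $X$. A minimal forbidden word of $X$ is a finite word not in $\mathcal{L}(X)$ all of whose proper subwords lie in $\mathcal{L}(X)$; $\mathcal{M}_n(X)$ is the set of those of length $n$. The SFT cover of a subshift $X$ is the sequence $(X_k)_{k\ge1}$ where $X_k$ is the set of $x\in\mathcal{A}^{\mathbb{Z}}$ in which no word of $\bigcup_{m=1}^k\mathcal{M}_m(X)$ occurs. The upper Banach density of $S\subseteq\mathbb{N}$ is $d^*(S)=\limsup_{n}\max_k |S\cap\{k,\dots,k+n-1\}|/n$; $X$ is language stable if $\{n\colon\mathcal{M}_n(X)=\emptyset\}$ has upper Banach density $1$. The shift $Z$: $\alpha\in(0,1)$ is irrational and $R_\alpha(x)=x+\alpha\pmod1$ on $[0,1)$. For $\beta\in(0,1)$, $X_\beta\subseteq\{0,1\}^{\mathbb{Z}}$ is the closure of the set of sequences $(x_j)_{j\in\mathbb{Z}}$, $x\in[0,1)$,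 with $x_j=0$ if $R_\alpha^jx\in[0,\beta)$ and $x_j=1$ otherwise. $(\beta_i)_{i\ge1}$ is a strictly increasing sequence in $\{n\alpha\pmod1\colon n\ge1\}$ with $\lim_i\beta_i=\alpha$, chosen so that $Z:=\overline{\bigcup_{i}X_{\beta_i}}$ is language stable. Put $Z_j:=X_{\beta_j}$ ($j\in\mathbb{N}$) and $Z_c:=X_\alpha$. The shift $X$: fix intervals $\{i_n,\dots,i_n+j_n\}$, with $(i_n)$ and $(j_n)$ strictly increasing, such that the $i_n$-th and $(i_n+j_n)$-th terms of the SFT cover of $Z$ coincide for all $n$. $X\subseteq\{0,1\}^{\mathbb{Z}}$ is a language stable, minimal subshift with $h_{\mathrm{top}}(X)>0$, such that the $i_n$-th and $(i_n+j_n)$-th terms of the SFT cover of $X$ coincide for infinitely many $n$, and such that $X\times Z_c$ and all $X\times Z_j$ ($j\in\mathbb{N}$) are minimal. *)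

(* Defs.v *)
From HB Require Import structures.
From mathcomp Require Import all_boot all_order all_algebra.
From mathcomp Require Import all_classical all_reals all_analysis.

Set Implicit Arguments.
Unset Strict Implicit.
Unset Printing Implicit Defensive.
Import Order.TTheory GRing.Theory Num.Theory.
Import numFieldNormedType.Exports.
Local Open Scope classical_set_scope.
Local Open Scope ring_scope.

(* Function types carry no topology by default: [fullshift A] is int -> A with
   the product of the discrete topologies. *)
Definition fullshift (A : finType) : Type :=
  prod_topology (fun _ : int => discrete_topology A).
HB.instance Definition _ (A : finType) :=
  Topological.copy (fullshift A)
    (prod_topology (fun _ : int => discrete_topology A)).

Section Subshifts.
Variable A : finType.
Implicit Types (X Y W : set (fullshift A)) (w u : seq A).

Definition left_shift (x : fullshift A) : fullshift A := fun i => x (i + 1).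

Definition subshift X := [/\ closed X, X !=set0 & left_shift @` X = X].

Definition minimal X :=
  subshift X /\ forall Y, subshift Y -> Y `<=` X -> Y = X.

Definition occurs w (x : fullshift A) :=
  exists i : int, w = [seq x (i + k%:Z) | k <- iota 0 (size w)].

Definition language X : set (seq A) := [set w | exists2 x, X x & occurs w x].

Definition minimal_forbidden X n : set (seq A) :=
  [set w | [/\ size w = n, ~ language X w &
    forall u, infix u w -> u != w -> language X u]].

Definition sft_cover X k : set (fullshift A) :=
  [set x | forall m w, (1 <= m <= k)%N -> minimal_forbidden X m w ->
     ~ occurs w x].

End Subshifts.

Definition prod_shift (A B : finType) (X : set (fullshift A))
    (Y : set (fullshift B)) : set (fullshift (A * B)%type) :=
  [set z | X (fun i => (z i).1) /\ Y (fun i => (z i).2)].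

(* The maximum over k is written as a supremum; it is attained, since for each
   n only finitely many values are possible. *)
Definition upper_banach_density (R : realType) (S : set nat) : R :=
  limn_sup (fun n => sup
    (range (fun k => #|[pred i : 'I_n | `[< S (k + i)%N >]]|%:R / n%:R))).

Definition language_stable (R : realType) (A : finType)
    (X : set (fullshift A)) :=
  upper_banach_density R [set n | minimal_forbidden X n = set0] = 1.

(* The limit exists for every subshift, by subadditivity. *)
Definition htop (R : realType) (A : finType) (X : set (fullshift A)) : R :=
  limn (fun n =>
    ln #|[pred w : n.-tuple A | `[< language X w >]]|%:R / n%:R).

Section Rotation.
Variable R : realType.

Definition mod1 (x : R) : R := x - (Num.floor x)%:~R.

(* The j-th iterate, j in Z, of x |-> x + alpha (mod 1). *)
Definition rotation (alpha : R) (j : int) (x : R) : R :=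
  mod1 (x + j%:~R * alpha).

(* The letters 0 and 1 are false and true. *)
Definition rotation_coding (alpha beta x : R) : fullshift bool :=
  fun j => rotation alpha j x \notin `[0, beta[.

Definition rotation_shift (alpha beta : R) : set (fullshift bool) :=
  closure [set rotation_coding alpha beta x | x in `[0, 1[].

(* Only the indices i >= 1 of beta are used. *)
Definition rotation_union_shift (alpha : R) (beta : nat -> R) :
    set (fullshift bool) :=
  closure (\bigcup_(i in [set i | (1 <= i)%N]) rotation_shift alpha (beta i)).

End Rotation.

(* The coercion of W to a type is its subtype, with the subspace topology.
   Commutation with the shift is relational so that the type can be formed
   before W is known to be shift-invariant; for invariant W and injective f the
   field [aut_shift] says exactly that f commutes with the shift. The inverse is
   determined by [aut_fun], see [aut_eq]. *)
Record aut (A : finType) (W : set (fullshift A)) := Aut {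
  aut_fun :> W -> W;
  aut_inv : W -> W;
  aut_funK : cancel aut_fun aut_inv;
  aut_invK : cancel aut_inv aut_fun;
  aut_continuous : continuous aut_fun;
  aut_inv_continuous : continuous aut_inv;
  aut_shift : forall x y : W, set_val y = left_shift (set_val x) <->
    set_val (aut_fun y) = left_shift (set_val (aut_fun x))
}.

Section AutGroup.
Variables (A : finType) (W : set (fullshift A)).
Implicit Types f g h : aut W.

Lemma aut_eq f g : aut_fun f =1 aut_fun g -> f = g.
Proof.
case: f => f f' fK f'K cf cf' sf; case: g => g g' gK g'K cg cg' sg /= fg.
have {}fg : f = g by exact/funext.
subst g; have f'g' : f' = g'.
  by apply/funext => x; rewrite -[in LHS](g'K x) fK.
by subst g'; congr Aut; exact: Prop_irrelevance.
Qed.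

Lemma aut_shift_id (x y : W) :
  set_val y = left_shift (set_val x) <-> set_val y = left_shift (set_val x).
Proof. by []. Qed.

Definition aut_one : aut W :=
  @Aut A W id id (fun=> erefl) (fun=> erefl)
    (fun x => @cvg_id _ _) (fun x => @cvg_id _ _) aut_shift_id.

Lemma aut_inv_shift f (x y : W) : set_val y = left_shift (set_val x) <->
  set_val (aut_inv f y) = left_shift (set_val (aut_inv f x)).
Proof.
by have := aut_shift f (aut_inv f x) (aut_inv f y); rewrite !aut_invK => -[].
Qed.

Definition aut_invg f : aut W :=
  Aut (@aut_invK _ _ f) (@aut_funK _ _ f) (@aut_inv_continuous _ _ f)
    (@aut_continuous _ _ f) (aut_inv_shift f).

Lemma aut_mul_continuous f g : continuous (f \o g).
Proof. by move=> x; apply: continuous_comp; exact: aut_continuous. Qed.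

Lemma aut_mul_inv_continuous f g : continuous (aut_inv g \o aut_inv f).
Proof. by move=> x; apply: continuous_comp; exact: aut_inv_continuous. Qed.

Lemma aut_mul_shift f g (x y : W) : set_val y = left_shift (set_val x) <->
  set_val ((f \o g) y) = left_shift (set_val ((f \o g) x)).
Proof. exact: iff_trans (aut_shift g x y) (aut_shift f (g x) (g y)). Qed.

Definition aut_mul f g : aut W :=
  Aut (can_comp (@aut_funK _ _ f) (@aut_funK _ _ g))
    (can_comp (@aut_invK _ _ g) (@aut_invK _ _ f))
    (@aut_mul_continuous f g) (@aut_mul_inv_continuous f g)
    (aut_mul_shift f g).

Lemma aut_mulA : associative aut_mul.
Proof. by move=> f g h; exact: aut_eq. Qed.

Lemma aut_mul1g : left_id aut_one aut_mul.
Proof. by move=> f; exact: aut_eq. Qed.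

Lemma aut_mulg1 : right_id aut_one aut_mul.
Proof. by move=> f; exact: aut_eq. Qed.

Lemma aut_mulVg : left_inverse aut_one aut_invg aut_mul.
Proof. by move=> f; apply: aut_eq => x; exact: aut_funK. Qed.

Lemma aut_mulgV : right_inverse aut_one aut_invg aut_mul.
Proof. by move=> f; apply: aut_eq => x; exact: aut_invK. Qed.

HB.instance Definition _ := gen_eqMixin (aut W).
HB.instance Definition _ := gen_choiceMixin (aut W).
HB.instance Definition _ :=
  isGroup.Build (aut W) aut_mulA aut_mul1g aut_mulg1 aut_mulVg aut_mulgV.

End AutGroup.

(* Amenability as a discrete group: there is a left-invariant, finitely
   additive probability measure on all subsets. *)
Definition amenable (R : realType) (G : groupType) :=
  exists mu : set G -> R,
    [/\ forall S, 0 <= mu S,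
        mu setT = 1,
        forall S T, S `&` T = set0 -> mu (S `|` T) = mu S + mu T &
        forall (g : G) S, mu [set (g * x)%g | x in S] = mu S].

(* Main.v *)
(* Countability is the Curtis-Hedlund-Lyndon theorem: W is compact and
   shift-invariant, so an automorphism is given by a finite local rule.

   For non-amenability only the full-shift factor Y matters. In y : Z -> {0,1},
   occurrences of the pattern 001*1*1 do not overlap, so their two wildcards are
   two tracks of free data bits, and adding to one track a shifted copy of the
   other is an involutive automorphism. On points whose data are Laurent series
   (p, q) over F_2, these act as the shears p += t^-k q and q += t^-k p. The
   shears with k = 1, 2 map all nonzero pairs whose p does not start strictly
   before q to disjoint sets of pairs whose p does, so an invariant mean would
   give the latter set mass at least 2/3, and by symmetry also the set where q
   starts strictly before p, which is disjoint from it. *)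
Require Import Defs.
From mathcomp Require Import all_boot all_order all_algebra.
From mathcomp Require Import all_classical all_reals all_analysis.
From mathcomp Require Import zify lra.
Set Implicit Arguments.
Unset Strict Implicit.
Unset Printing Implicit Defensive.
Import Order.TTheory GRing.Theory Num.Theory.
Import numFieldNormedType.Exports.
Local Open Scope classical_set_scope.
Local Open Scope ring_scope.

(** * Cylinder neighbourhoods and compactness of the full shift *)

Section Cylinders.
Variable A : finType.
Implicit Types x y : fullshift A.

Definition cylinder x (M : nat) : set (fullshift A) :=
  [set y | forall i : int, (`|i| <= M)%N -> y i = x i].

Lemma cylinderW x m n : (m <= n)%N -> cylinder x n `<=` cylinder x m.
Proof. by move=> mn y xy i im; apply: xy; exact: leq_trans mn. Qed.

Lemma nbhs_coord x (i : int) : nbhs x [set y : fullshift A | y i = x i].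
Proof.
have := @proj_continuous int (fun=> discrete_topology A) i x.
by move/(_ _ (discrete_set1 (x i : discrete_topology A))).
Qed.

Lemma cylinder_nbhs x M : nbhs x (cylinder x M).
Proof.
elim: M => [|M IH].
  apply: filterS (nbhs_coord x 0) => y /= yx i i0.
  by have -> : i = 0 by lia.
apply: filterS (filterI IH (filterI (nbhs_coord x M.+1) (nbhs_coord x (- M.+1%:Z)))).
move=> y [/= yM [yp yn]] i iM.
have [->|[->|/yM//]] : i = M.+1%:Z \/ (i = - M.+1%:Z \/ (`|i| <= M)%N) by lia.
- exact: yp.
- exact: yn.
Qed.

Lemma nbhs_cylinder x (U : set (fullshift A)) :
  nbhs x U -> exists M, cylinder x M `<=` U.
Proof.
pose F := filter_from setT (cylinder x).
have FF : Filter F.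
  apply: filter_from_filter; first by exists 0%N.
  move=> m n _ _; exists (maxn m n) => //.
  by move=> y xy; split; apply: cylinderW xy; rewrite ?leq_maxl ?leq_maxr.
(* The product topology is the supremum of the coordinate topologies, so convergence of the filter
   of cylinders can be checked one coordinate at a time. *)
suff cF : F --> x by move=> /cF[M _ MU]; exists M.
apply/cvg_sup => i.
move=> U' [V [[B oB <-] Bx BU']].
exists `|i|%N => // y yx; apply: BU'; rewrite /= /proj in Bx *.
by rewrite (yx i).
Qed.

Lemma fullshift_compact : compact [set: fullshift A].
Proof.
have T (i : int) : compact [set: discrete_topology A].
  by apply: finite_compact; exact: finite_finset.
by have := tychonoff T; congr compact; apply/seteqP.
Qed.

Lemma closed_compact_fullshift (W : set (fullshift A)) : closed W -> compact W.
Proof. by move=> cW; apply: subclosed_compact cW fullshift_compact _. Qed.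

Lemma nbhs_set_type (W : set (fullshift A)) (x : W) (U : set W) :
  nbhs x U <-> exists M, forall y : W, cylinder (set_val x) M (set_val y) -> U y.
Proof.
split=> [[V [[B oB <-] Bx BU]]|[M MU]].
  have [M MB] := nbhs_cylinder (open_nbhs_nbhs (conj oB Bx)).
  by exists M => y /MB/BU.
have Vc : continuous (set_val : W -> fullshift A) by exact: initial_continuous.
exact: filterS MU (Vc x _ (cylinder_nbhs (set_val x) M)).
Qed.

End Cylinders.

(** * Local rules and countability of the automorphism group *)

Section Countability.
Variables (A : finType) (W : set (fullshift A)).
Implicit Types f g : aut W.
Hypotheses (closedW : closed W) (shiftW : @left_shift A @` W = W).

Definition has_window M f := forall x y : W,
  cylinder (set_val x) M (set_val y) ->
  set_val (f y) 0 = set_val (f x) 0.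

Lemma aut_nbhs_coord f (x : W) :
  nbhs x [set y : W | set_val (f y) 0 = set_val (f x) 0].
Proof.
apply: (@aut_continuous _ _ f x [set z | set_val z 0 = set_val (f x) 0]).
by apply/nbhs_set_type; exists 0%N => y; exact.
Qed.

(* Curtis-Hedlund-Lyndon: pairs violating every window would cluster, by
   compactness, at a point of discontinuity. *)
Lemma aut_has_window f : exists M, has_window M f.
Proof.
apply: contrapT => /forallNP noM.
have {noM} /choice[p pP] M : exists p : W * W,
    cylinder (set_val p.1) M (set_val p.2) /\
    set_val (f p.2) 0 <> set_val (f p.1) 0.
  have /existsNP[x /existsNP[y /not_implyP[cxy fxy]]] := noM M.
  by exists (x, y).
pose u n := set_val (p n).1.
have [|q [Wq Fq]]  := @closed_compact_fullshift _ _ closedW (u @ \oo) _.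
  by exists 0%N => // n _; exact: set_valP.
pose q' : W := exist _ q (mem_set Wq).
have /nbhs_set_type[M MP] := aut_nbhs_coord f q'.
(* With an index [n] at least [M], both members of [p n] lie in the cylinder of radius [M] around
   [q], where the letter at 0 of the image under [f] is constant. *)
have [|_ [[n /= Mn <-] qn]] :=
    Fq [set u n | n in [set n | (M <= n)%N]] _ _ (cylinder_nbhs q M).
  by exists M => // n /= Mn; exists n.
have [cn] := pP n; apply; rewrite (MP _ qn) (MP (p n).2)// => i iM.
apply: etrans (qn i iM); exact: cylinderW cn i iM.
Qed.

Lemma set_type_shift (x : W) : exists y : W, set_val y = left_shift (set_val x).
Proof.
have Wl y : W y -> W (left_shift y) by move=> Wy; rewrite -shiftW; exists y.
pose y : W := exist _ (left_shift (set_val x)) (mem_set (Wl _ (set_valP x))).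
by exists y.
Qed.

Lemma set_type_unshift (x : W) :
  exists y : W, set_val x = left_shift (set_val y).
Proof.
have Wr z : W z -> exists2 y, W y & left_shift y = z by rewrite -{1}shiftW.
have [y Wy yx] := Wr _ (set_valP x).
by exists (exist _ y (mem_set Wy)).
Qed.

(** The point [y] is [x] shifted by [n]; being chosen before [f], it serves to compare two
    automorphisms. *)
Lemma aut_coord (x : W) (n : int) :
  exists y : W, forall f, set_val (f x) n = set_val (f y) 0.
Proof.
suff [y yP] : exists y : W, forall f i, set_val (f x) (i + n) = set_val (f y) i.
  by exists y => f; rewrite -yP add0r.
elim: n => [|n [y yP]|n [y yP]].
- by exists x => f i; rewrite addr0.
- have [z zP] := set_type_shift y; exists z => f i.
  have /(aut_shift f) -> := zP; rewrite /left_shift -yP; congr (set_val _ _); lia.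
- have [z zP] := set_type_unshift y; exists z => f i.
  have /(aut_shift f) := zP => /(congr1 (fun s => s (i - 1))).
  rewrite /left_shift subrK -yP => <-; congr (set_val _ _); lia.
Qed.

Definition window M (x : fullshift A) : {ffun 'I_M.*2.+1 -> A} :=
  [ffun i : 'I_M.*2.+1 => x (i%:Z - M%:Z)].

Lemma window_cylinder M x y : window M x = window M y -> cylinder x M y.
Proof.
move=> /ffunP xy i iM.
have iM' : (`|(i + M%:Z)%R| < M.*2.+1)%N by lia.
have := xy (Ordinal iM'); rewrite !ffunE /=.
by have -> : (`|(i + M%:Z)%R|%N)%:Z - M%:Z = i by lia.
Qed.

(** A graph rather than a function, since not every word need occur in [W]; it lives in a finite
    type, so [pickle] encodes it. *)
Definition local_rule M f : {set {ffun 'I_M.*2.+1 -> A} * A} :=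
  [set p | `[< exists x : W,
     window M (set_val x) = p.1 /\ set_val (f x) 0 = p.2 >]].

(** The pair that [f] realises at [y] is realised for [g] at some [x] with the same window, and the
    window property of [g] carries the letter back to [y]. *)
Lemma local_rule_inj M f g :
  has_window M g -> local_rule M f = local_rule M g -> f = g.
Proof.
move=> gM fg; apply: aut_eq => x.
suff : set_val (f x) = set_val (g x) by exact: val_inj.
apply/funext => n.
have [y yP] := aut_coord x n; rewrite !yP {yP x}.
have : (window M (set_val y), set_val (f y) 0) \in local_rule M g.
  by rewrite -fg inE; apply/asboolP; exists y.
rewrite inE => /asboolP[x [/= xy <-]].
by apply/esym/gM/window_cylinder.
Qed.

Lemma aut_countable : countable [set: aut W].
Proof.
have -> : [set: aut W] = \bigcup_M has_window M.
  apply/seteqP; split=> // f _.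
  by have [M fM] := aut_has_window f; exists M.
apply: bigcup_countable => // M _; apply/countable_injP.
exists (pickle \o local_rule M) => f g _ /set_mem gM /(pcan_inj pickleK).
exact: local_rule_inj.
Qed.

End Countability.

(** * Transfer of a mean from a group to an action *)

Section TransferredMean.
Variables (R : realType) (G : groupType) (T : Type) (act : G -> T -> T).
Hypotheses (act1 : forall x, act 1%g x = x)
  (actM : forall g h x, act (g * h)%g x = act g (act h x)).

Lemma actK g : cancel (act g) (act g^-1%g).
Proof. by move=> x; rewrite -actM mulVg act1. Qed.

Lemma actVK g : cancel (act g^-1%g) (act g).
Proof. by move=> x; rewrite -actM mulgV act1. Qed.

Definition stabilises (O : set T) (g : G) := forall x, O (act g x) <-> O x.

Lemma stabilisesM O g h :
  stabilises O g -> stabilises O h -> stabilises O (g * h)%g.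
Proof. by move=> Og Oh x; rewrite actM; exact: iff_trans (Og _) (Oh x). Qed.

Lemma stabilisesV O g : stabilises O g -> stabilises O g^-1%g.
Proof. by move=> Og x; rewrite -(Og (act g^-1%g x)) actVK. Qed.

(* A transversal rep of the right cosets of the stabiliser H of O writes every
   element of G as an element of H times its representative; the mean on G is
   pushed forward along g |-> act (g * (rep g)^-1) w, which is H-equivariant. *)
Lemma amenable_invariant_mean (O : set T) : amenable R G -> O !=set0 ->
  exists m : set T -> R,
    [/\ forall S, 0 <= m S,
        m O = 1,
        forall S S', S `&` S' = set0 -> m (S `|` S') = m S + m S' &
        forall g S, stabilises O g -> m (act g @` S) = m S].
Proof.
move=> [mu [mu_ge0 muT muD muM]] [w Ow].
pose coset (g : G) := [set g' | stabilises O (g' * g^-1)%g].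
pose rep (g : G) := xget 1%g (coset g).
have coset_refl g : coset g g.
  by move=> x; rewrite mulgV act1.
have repP g : stabilises O (rep g * g^-1)%g.
  exact: xgetI (coset_refl g).
have repM h g : stabilises O h -> rep (h * g)%g = rep g.
  move=> Oh; have E : coset (h * g)%g = coset g.
    apply/seteqP; split=> g'; rewrite /coset /= invgM mulgA => Og'.
      by have := stabilisesM Og' Oh; rewrite mulgVK.
    exact: stabilisesM Og' (stabilisesV Oh).
  by rewrite /rep E.
pose k g := (g * (rep g)^-1)%g.
have kO g : stabilises O (k g).
  by have := stabilisesV (repP g); rewrite invgM invgK.
have kM h g : stabilises O h -> k (h * g)%g = (h * k g)%g.
  by move=> Oh; rewrite /k repM// mulgA.
pose pull (S : set T) := [set g | S (act (k g) w)].
exists (mu \o pull); split=> /=.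
- by move=> S; exact: mu_ge0.
- rewrite -[RHS]muT; congr mu; apply/seteqP; split=> // g _.
  by apply/(kO g).
- move=> S S' SS'; rewrite -muD//.
  apply/seteqP; split=> // g [Sg S'g].
  have : (S `&` S') (act (k g) w) by [].
  by rewrite SS'.
- move=> h S Oh; rewrite -(muM h (pull S)); congr mu.
  apply/seteqP; split=> [g [x Sx xg]|_ [g Sg <-]]; rewrite /pull /=.
    exists (h^-1 * g)%g; last by rewrite mulgA mulgV mul1g.
    rewrite /pull/= kM; last exact: stabilisesV.
    by rewrite actM -xg actK.
  by exists (act (k g) w) => //; rewrite kM// actM.
Qed.

End TransferredMean.

(** * Ping-pong for invariant means *)

Section PingPong.
Variables (R : realType) (G : groupType) (T : Type) (act : G -> T -> T).
Hypotheses (act1 : forall x, act 1%g x = x)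
  (actM : forall g h x, act (g * h)%g x = act g (act h x)).

(* For an invariant mean m, both images of the complement of B s have mass
   1 - m (B s), so m (B s) >= 2 (1 - m (B s)), that is m (B s) >= 2/3. *)
Lemma ping_pong_not_amenable (O : set T) (B : bool -> set T)
    (g : bool -> bool -> G) :
  O !=set0 ->
  (forall s, B s `<=` O) ->
  B true `&` B false = set0 ->
  (forall s i, stabilises act O (g s i)) ->
  (forall s i, act (g s i) @` (O `\` B s) `<=` B s) ->
  (forall s, act (g s true) @` (O `\` B s) `&`
             act (g s false) @` (O `\` B s) = set0) ->
  ~ amenable R G.
Proof.
move=> O0 BO B0 Og gB g0 /(amenable_invariant_mean act1 actM)/(_ O0).
move=> [m [m_ge0 mO mD mM]].
have mS S S' : S `<=` S' -> m S <= m S'.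
  move=> SS'; have -> : S' = S `|` (S' `\` S) by rewrite setDUK.
  by rewrite mD ?setDIK// lerDl.
have mB s : 2 <= 3 * m (B s).
  have mC : m (O `\` B s) = 1 - m (B s).
    apply/eqP; rewrite eq_sym subr_eq addrC -mD ?setDIK//.
    by rewrite setDUK// mO.
  have : m (act (g s true) @` (O `\` B s) `|`
            act (g s false) @` (O `\` B s)) <= m (B s).
    by apply: mS => x [] /gB.
  by rewrite mD// !mM// mC; lra.
(* Two disjoint subsets of mass at least 2/3 each cannot fit in [O], of mass 1. *)
have : m (B true `|` B false) <= m O by apply: mS => x [] /BO.
by rewrite mD// mO; have := mB true; have := mB false; lra.
Qed.

End PingPong.

(** * Block markers and shears between two data tracks *)

Section Markers.
Implicit Types (y : int -> bool) (s : bool) (i j : int).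

(* The pattern 001*1*1, whose wildcards carry the two data bits. *)
Definition block y j : bool :=
  [&& ~~ y j, ~~ y (j + 1), y (j + 2), y (j + 4) & y (j + 6)].

Definition data_pos s : int := if s then 5 else 3.

Definition marker_pos (c : int) : bool := c \in [:: 0; 1; 2; 4; 6].

(** If [j' = j + t] with 0 < t < 7, a leading zero of the block at [j'] falls on a 1 of the block at
    [j]: the first zero for even t, the second for odd t. *)
Lemma block_overlap y j j' : block y j -> block y j' ->
  (`|(j' - j)%R| < 7)%N -> j' = j.
Proof.
wlog: j j' / j <= j'.
  move=> H bj bj' jj'; have [le|/ltW le] := leP j j'; first exact: H.
  by apply/esym/H => //; lia.
move=> le /and5P[j0 j1 j2 j4 j6] /and5P[j0' j1' _ _ _] jj'.
have [t [tj t7]] : exists t : nat, j' = j + t%:Z /\ (t < 7)%N.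
  by exists `|(j' - j)%R|%N; lia.
subst j'; clear jj' le.
have E a b : j + a + 1 = j + b -> y (j + a + 1) = y (j + b) by move=> ->.
case: t t7 j0' j1' => [|[|[|[|[|[|[|t]]]]]]] //= _ j0' j1'.
- by rewrite addr0.
- by rewrite (E _ 2) ?j2 in j1'; lia.
- by rewrite j2 in j0'.
- by rewrite (E _ 4) ?j4 in j1'; lia.
- by rewrite j4 in j0'.
- by rewrite (E _ 6) ?j6 in j1'; lia.
- by rewrite j6 in j0'.
Qed.

(* Adds to the bit s of each block the bit ~~ s of the k-th next block,
   whenever the latter position carries a block too. *)
Definition shear s (k : nat) y : int -> bool := fun i =>
  let j := i - data_pos s in
  y i (+) [&& block y j, block y (j + 7 * k%:Z) &
              y (j + 7 * k%:Z + data_pos (~~ s))].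

Lemma shear_off s k y i : ~~ block y (i - data_pos s) -> shear s k y i = y i.
Proof. by rewrite /shear => /negbTE ->; rewrite addbF. Qed.

(** Changing the letter at [j + c] takes a block at [j + c - data_pos s]; non-overlap forces it to
    be the one at [j], so that [c = data_pos s]. *)
Lemma shear_block_fixed s k y j c : block y j ->
  (c == data_pos (~~ s)) || marker_pos c -> shear s k y (j + c) = y (j + c).
Proof.
move=> bj cP; apply: shear_off; apply/negP => /(block_overlap bj).
by case: s cP; rewrite /marker_pos /data_pos /= !inE => cP E;
   move: E cP; case: eqP => [->|_]; lia.
Qed.

(** No block is created either: a changed letter lies in a block of [y], which survives the shear
    and would overlap the new one. *)
Lemma shear_block s k y : block (shear s k y) =1 block y.
Proof.
have sub j : block y j -> block (shear s k y) j.
  move=> bj; rewrite /block -{1}[j]addr0 !shear_block_fixed//= ?orbT// addr0.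
  exact: bj.
move=> j; apply/idP/idP; last exact: sub.
move=> bj; suff E c : marker_pos c -> shear s k y (j + c) = y (j + c).
  by move: bj; rewrite /block -{1 6}[j]addr0 !E.
move=> cP; apply: shear_off; apply/negP => /sub /(block_overlap bj).
by case: s {bj sub} cP; rewrite /marker_pos /data_pos /= !inE => cP; lia.
Qed.

(** Block positions and the track [~~ s] are left alone, so the same bit is added twice. *)
Lemma shearK s k y : shear s k (shear s k y) =1 y.
Proof.
move=> i; rewrite {1}/shear !shear_block.
have [bj|bj] /= := boolP (block y (i - data_pos s)); last first.
  by rewrite addbF shear_off.
have [bk|bk] /= := boolP (block y _); last first.
  by rewrite addbF /shear bj (negbTE bk) /= addbF.
by rewrite shear_block_fixed ?eqxx// /shear bj bk /= -addbA addbb addbF.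
Qed.

Lemma shear_shift s k y i :
  shear s k (fun i => y (i + 1)) i = shear s k y (i + 1).
Proof.
rewrite /shear /block.
have E a b : a = b -> y a = y b by move=> ->.
by congr (_ (+) [&& [&& ~~ _, ~~ _, _, _ & _], [&& ~~ _, ~~ _, _, _ & _] & _]);
   apply: E; lia.
Qed.

(** The letters read lie between [i - 5] and [i + 7k + 3]; the radius is a generous bound. *)
Lemma shear_local s k y y' i :
  (forall j, (`|(j - i)%R| <= 7 * k + 12)%N -> y j = y' j) ->
  shear s k y i = shear s k y' i.
Proof.
move=> E; rewrite /shear /block.
by congr (_ (+) [&& [&& ~~ _, ~~ _, _, _ & _], [&& ~~ _, ~~ _, _, _ & _] & _]);
   apply: E; rewrite ?/data_pos; case: s => /=; lia.
Qed.

Definition data s y (n : int) : bool := y (7 * n + data_pos s).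

Definition all_blocks y := forall n : int, block y (7 * n).

Lemma data_shear s s' k y n : all_blocks y ->
  data s' (shear s k y) n =
  data s' y n (+) ((s' == s) && data (~~ s) y (n + k%:Z)).
Proof.
move=> yb; rewrite /data; case: eqP => [->|/eqP s's] /=.
  rewrite /shear addrK yb /=.
  have -> : 7 * n + 7 * k%:Z = 7 * (n + k%:Z) by lia.
  by rewrite yb.
by rewrite addbF shear_block_fixed//; case: s s' s's => [] [].
Qed.

(** These encode pairs of Laurent series over F_2, not both zero, written on blocks that tile the
    line. *)
Definition good_config y :=
  [/\ all_blocks y, exists N : int, forall s (n : int), n < N -> ~~ data s y n &
      exists s n, data s y n].

Lemma good_shear s k y : good_config y -> good_config (shear s k y).
Proof.
move=> [yb [N yN] [s' [n yn]]]; split.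
- by move=> m; rewrite shear_block.
(* The bit added at [m] comes from [m + k], so the vanishing range retreats by [k]. *)
- exists (N - k%:Z) => t m mN; rewrite data_shear//.
  rewrite (negbTE (yN t m _)) 1?(negbTE (yN (~~ s) (m + k%:Z) _)) ?andbF//; lia.
(* If the track [~~ s] vanishes, the shear changes no data; otherwise that track is nonzero and
   stays as it is. *)
- have [ys|/existsNP[m /contrapT ym]] := pselect (forall m, ~ data (~~ s) y m).
    exists s', n; rewrite data_shear// yn; case: eqP => //= _.
    by apply/negP/ys.
  by exists (~~ s), m; rewrite data_shear// ym; case: (s).
Qed.

Lemma good_shearE s k y : good_config (shear s k y) <-> good_config y.
Proof.
split; last exact: good_shear.
by move=> /(good_shear s k); have -> : shear s k (shear s k y) = y by exact/funext/shearK.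
Qed.

Definition first_one s y (m : int) :=
  data s y m /\ forall j, j < m -> ~~ data s y j.

Lemma ex_first_one s y : good_config y -> (exists n, data s y n) ->
  exists m, first_one s y m.
Proof.
move=> [_ [N yN] _] [n yn].
have Nn : N <= n by rewrite leNgt; apply/negP => /(yN s); rewrite yn.
(* Counting from [N] gives natural indices, among which a least one exists. *)
pose P (r : nat) := data s y (N + r%:Z).
have exP : exists r, P r.
  by exists `|(n - N)%R|%N; rewrite /P; have -> : N + (`|(n - N)%R|%N)%:Z = n by lia.
case: (ex_minnP exP) => r Pr rmin; exists (N + r%:Z); split=> // j jr.
have [jN|jN] := ltP j N; first exact: yN.
apply/negP => yj.
have /rmin : P `|(j - N)%R|%N.
  by rewrite /P; have -> : N + (`|(j - N)%R|%N)%:Z = j by lia.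
lia.
Qed.

Lemma first_one_inj s y m m' : first_one s y m -> first_one s y m' -> m = m'.
Proof.
move=> [ym ymN] [ym' ym'N]; case: (ltgtP m m') => // [/ym'N|/ymN].
  by rewrite ym.
by rewrite ym'.
Qed.

(** Strict inequality between the orders of the two series, the zero series having infinite
    order. *)
Definition dominates s : set (int -> bool) :=
  [set y | good_config y /\
    exists2 n, data s y n & forall m, m <= n -> ~~ data (~~ s) y m].

(** Recording the exact difference of the orders makes the sets for distinct [k] disjoint. *)
Definition dominates_by s (k : nat) : set (int -> bool) :=
  [set y | good_config y /\
    exists2 m, first_one (~~ s) y m & first_one s y (m - k%:Z)].

Lemma dominates_byW s k : (0 < k)%N -> dominates_by s k `<=` dominates s.
Proof.
move=> k0 y [gy [m [ym ymN] [ymk _]]]; split=> //; exists (m - k%:Z) => // j jm.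
by apply: ymN; lia.
Qed.

Lemma dominates_by_disjoint s k k' : k != k' ->
  dominates_by s k `&` dominates_by s k' = set0.
Proof.
move=> kk'; apply/seteqP; split=> // y [[_ [m ym ymk]] [_ [m' ym' ymk']]].
have mm' := first_one_inj ym ym'; subst m'.
by have := first_one_inj ymk ymk'; lia.
Qed.

Lemma dominates_disjoint : dominates true `&` dominates false = set0.
Proof.
apply/seteqP; split=> // y [[_ [n yn ny]] [_ [m ym my]]].
have [nm|/ltW mn] := leP n m.
  by have := my _ nm; rewrite /= yn.
by have := ny _ mn; rewrite /= ym.
Qed.

(** Without domination the other series is nonzero, of some order [m], and series [s] has order at
    least [m]; adding t^-k times the former puts the leading term of [s] at [m - k]. *)
Lemma shear_dominates s k y : (0 < k)%N ->
  good_config y -> ~ dominates s y -> dominates_by s k (shear s k y).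
Proof.
move=> k0 gy ndom; split; first exact: good_shear.
have [yb _ [s' [n yn]]] := gy.
have dom' j : data s y j -> exists2 m, m <= j & data (~~ s) y m.
  move=> yj; apply: contrapT => H; apply: ndom; split=> //; exists j => // m mj.
  by apply/negP => ym; apply: H; exists m.
have [|m ym] := @ex_first_one (~~ s) _ gy.
  have [E|/eqP E] := eqVneq s' s; last by exists n; case: (s) s' E yn => [] [].
  by move: yn; rewrite E => /dom'[m _ ym]; exists m.
have ysN j : j < m -> ~~ data s y j.
  move=> jm; apply/negP => /dom'[i ij]; apply/negP/(proj2 ym); exact: le_lt_trans jm.
have Es i : data s (shear s k y) i = data s y i (+) data (~~ s) y (i + k%:Z).
  by rewrite data_shear// eqxx.
have En i : data (~~ s) (shear s k y) i = data (~~ s) y i.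
  by rewrite data_shear//; case: (s); rewrite addbF.
exists m; split.
- by rewrite En; case: ym.
- by move=> j jm; rewrite En; exact: (proj2 ym).
- by rewrite Es subrK (proj1 ym) (negbTE (ysN _ _))//; lia.
- move=> j jm; rewrite Es (negbTE (ysN _ _)); last lia.
  by apply: (proj2 ym); lia.
Qed.

Lemma ex_good_config : exists y, good_config y.
Proof.
(* Only markers, with all data zero except bit 0 of the track [false], at position 3. *)
pose y i := [|| i == 3 | (i %% 7)%Z \in [:: 2; 4; 6]].
have yE (i : int) : y i = [|| i == 3, (i %% 7)%Z == 2, (i %% 7)%Z == 4 | (i %% 7)%Z == 6].
  by rewrite /y !inE.
exists y; split.
- by move=> n; rewrite /block !yE; lia.
- by exists 0 => s n n0; rewrite /data yE /data_pos; case: s; lia.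
- by exists false, 0; rewrite /data yE.
Qed.

End Markers.

(** * Shift invariance and closedness of closures and products *)

Lemma closure_cylinderP (A : finType) (S : set (fullshift A)) x :
  closure S x <-> forall M, exists2 y, S y & cylinder x M y.
Proof.
split=> [clx M|clx U /nbhs_cylinder[M MU]].
  by have [y [Sy xy]] := clx _ (cylinder_nbhs x M); exists y.
by have [y Sy xy] := clx M; exists y; split=> //; exact: MU.
Qed.

Lemma closure_shift (A : finType) (S : set (fullshift A)) :
  @left_shift A @` S = S -> @left_shift A @` closure S = closure S.
Proof.
move=> SS; have Sl y : S y -> S (left_shift y).
  by move=> Sy; rewrite -SS; exists y.
have Sr y : S y -> exists2 z, S z & left_shift z = y by rewrite -{1}SS.
apply/seteqP; split=> [_ [x /closure_cylinderP clx <-]|x /closure_cylinderP clx].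
  (* Shifting moves coordinates by one, hence the radius [M.+1]. *)
  apply/closure_cylinderP => M; have [y Sy xy] := clx M.+1.
  by exists (left_shift y) => [|i iM]; [exact: Sl|apply: xy; lia].
exists (fun i => x (i - 1)).
  apply/closure_cylinderP => M; have [y Sy xy] := clx M.+1.
  have [z Sz zy] := Sr _ Sy; exists z => // i iM.
  by rewrite -xy; [rewrite -zy /left_shift subrK|lia].
by apply/funext => i; rewrite /left_shift addrK.
Qed.

Lemma bigcup_shift (A : finType) (I : Type) (D : set I)
    (F : I -> set (fullshift A)) :
  (forall i, D i -> @left_shift A @` F i = F i) ->
  @left_shift A @` (\bigcup_(i in D) F i) = \bigcup_(i in D) F i.
Proof. by move=> FF; rewrite image_bigcup; exact: eq_bigcupr. Qed.

Lemma prod_shift_shift (A B : finType) (X : set (fullshift A))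
    (Y : set (fullshift B)) :
  @left_shift A @` X = X -> @left_shift B @` Y = Y ->
  @left_shift _ @` prod_shift X Y = prod_shift X Y.
Proof.
move=> XX YY; apply/seteqP; split=> [_ [z [Xz Yz] <-]|z].
  by split; [rewrite -XX|rewrite -YY]; [exists (fun i => (z i).1)|exists (fun i => (z i).2)].
rewrite /prod_shift /= -{1}XX -{1}YY => -[[x Xx xz] [y Yy yz]].
exists (fun i => (x i, y i)); first by split.
apply/funext => i; rewrite [RHS]surjective_pairing.
by rewrite -(congr1 (fun f => f i) xz) -(congr1 (fun f => f i) yz).
Qed.

(** Yields the invariance of the rotation shifts, whose products with [X] are assumed minimal: pair
    [y] with a fixed [x], shift or unshift, and project. *)
Lemma prod_shift_factor (A B : finType) (X : set (fullshift A))
    (Y : set (fullshift B)) :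
  X !=set0 -> @left_shift _ @` prod_shift X Y = prod_shift X Y ->
  @left_shift B @` Y = Y.
Proof.
move=> [x Xx] XY.
have pairP y : Y y -> prod_shift X Y (fun i => (x i, y i)) by split.
apply/seteqP; split=> [_ [y Yy <-]|y Yy].
  have : prod_shift X Y (left_shift (fun i => (x i, y i) : A * B)).
    by rewrite -XY; exists (fun i => (x i, y i)) => //; exact: pairP.
  by case.
have := pairP y Yy; rewrite -{1}XY => -[z [_ Yz] zy].
exists (fun i => (z i).2) => //; apply/funext => i.
by have /= := congr1 (fun f => (f i).2) zy.
Qed.

Lemma closed_prod_shift (A B : finType) (X : set (fullshift A))
    (Y : set (fullshift B)) :
  closed X -> closed Y -> closed (prod_shift X Y).
Proof.
move=> cX cY z /closure_cylinderP clz; split.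
  apply/cX/closure_cylinderP => M; have [y [Xy _] yz] := clz M.
  by exists (fun i => (y i).1) => // i iM; rewrite yz.
apply/cY/closure_cylinderP => M; have [y [_ Yy] yz] := clz M.
by exists (fun i => (y i).2) => // i iM; rewrite yz.
Qed.

(** * Shears as automorphisms of a product with a full-shift factor *)

Section MiddleTrack.
Variables (X Z : set (fullshift bool)).
Let W := prod_shift (prod_shift X [set: fullshift bool]) Z.
Implicit Types w : fullshift (bool * bool * bool)%type.

Definition middle w : int -> bool := fun i => (w i).1.2.

Definition shear_word s k w : fullshift (bool * bool * bool)%type :=
  fun i => ((w i).1.1, shear s k (middle w) i, (w i).2).

Lemma shear_word_in s k w : W w -> W (shear_word s k w).
Proof. by move=> [[Xw _] Zw]. Qed.

Lemma shear_wordK s k : involutive (shear_word s k).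
Proof.
move=> w; apply/funext => i; rewrite /shear_word /= shearK /middle.
by case: (w i) => -[].
Qed.

Lemma shear_word_shift s k w :
  shear_word s k (left_shift w) = left_shift (shear_word s k w).
Proof.
apply/funext => i; rewrite /shear_word /left_shift /=.
by rewrite -(shear_shift s k (middle w)).
Qed.

Definition shear_map s k (w : W) : W :=
  exist _ (shear_word s k (set_val w)) (mem_set (shear_word_in s k (set_valP w))).

Lemma shear_mapK s k : involutive (shear_map s k).
Proof. by move=> w; apply: val_inj; exact: shear_wordK. Qed.

Lemma shear_map_continuous s k : continuous (shear_map s k).
Proof.
move=> w U /nbhs_set_type[M MU]; apply/nbhs_set_type.
exists (M + (7 * k + 12))%N => v wv; apply: MU => i iM.
have V u : set_val (shear_map s k u) = shear_word s k (set_val u) by [].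
rewrite !V /shear_word wv; last lia.
congr (_, _, _); apply: shear_local => j ji; rewrite /middle wv//; lia.
Qed.

Lemma shear_map_shift s k (x y : W) : set_val y = left_shift (set_val x) <->
  set_val (shear_map s k y) = left_shift (set_val (shear_map s k x)).
Proof.
have V v : set_val (shear_map s k v) = shear_word s k (set_val v) by [].
rewrite !V; split=> [->|E]; first exact: shear_word_shift.
by rewrite -[LHS](shear_wordK s k) E -shear_word_shift shear_wordK.
Qed.

Definition shear_aut s k : aut W :=
  Aut (@shear_mapK s k) (@shear_mapK s k) (@shear_map_continuous s k)
    (@shear_map_continuous s k) (shear_map_shift s k).

Lemma aut_full_shift_factor_not_amenable (R : realType) :
  X !=set0 -> Z !=set0 -> ~ amenable R (aut W).
Proof.
move=> [x Xx] [z Zz].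
pose pull (S : set (int -> bool)) : set W := [set w | S (middle (set_val w))].
(* The exponents are positive, to gain domination, and distinct, to make the two images disjoint. *)
pose g s (i : bool) := shear_aut s (if i then 1 else 2).
have gP (i : bool) : (0 < if i then 1 else 2)%N by case: i.
have gB s i v : (pull good_config `\` pull (dominates s)) v ->
    pull (dominates_by s (if i then 1 else 2)) (g s i v).
  by move=> [gv nv]; exact: shear_dominates (gP i) gv nv.
apply: (@ping_pong_not_amenable R (aut W) W (fun f : aut W => f) _ _
  (pull good_config) (fun s => pull (dominates s)) g) => //.
- have [y gy] := ex_good_config.
  pose v : fullshift (bool * bool * bool)%type := fun i => (x i, y i, z i).
  have Wv : W v by exact: conj (conj Xx I) Zz.
  by exists (exist _ v (mem_set Wv)).
- by move=> s v [].
- apply/seteqP; split=> // v [tv fv].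
  by have : (dominates true `&` dominates false) (middle (set_val v)) by []; rewrite dominates_disjoint.
- by move=> s i v; exact: good_shearE.
- by move=> s i _ [v /gB gv <-]; exact: dominates_byW (gP i) _ (gv i).
- move=> s; apply/seteqP; split=> // _ [[v /gB gv <-] [u /gB gu uv]].
  have : (dominates_by s 1 `&` dominates_by s 2) (middle (set_val (g s true v))).
    by split; [exact: gv true|rewrite -uv; exact: gu false].
  by rewrite dominates_by_disjoint.
Qed.

End MiddleTrack.

(** * Application to the subshifts [X] and [Z] *)

Theorem lemma6p17 (R : realType) (alpha : R) (beta : nat -> R)
    (i_ j_ : nat -> nat) (X : set (fullshift bool)) :
  let Z := rotation_union_shift alpha beta in
  (* alpha and (beta_i), i >= 1 *)
  0 < alpha < 1 ->
  irrational alpha ->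
  (forall i j, (1 <= i)%N -> (i < j)%N -> beta i < beta j) ->
  (forall i, (1 <= i)%N ->
     exists2 n, (1 <= n)%N & beta i = mod1 (n%:R * alpha)) ->
  beta @ \oo --> alpha ->
  language_stable R Z ->
  (* the intervals {i_n, ..., i_n + j_n} *)
  (forall n, (1 <= i_ n)%N) ->
  {homo i_ : m n / (m < n)%N} ->
  {homo j_ : m n / (m < n)%N} ->
  (forall n, sft_cover Z (i_ n) = sft_cover Z (i_ n + j_ n)) ->
  (* the subshift X *)
  minimal X ->
  language_stable R X ->
  0 < htop R X ->
  infinite_set
    [set n | sft_cover X (i_ n) = sft_cover X (i_ n + j_ n)] ->
  minimal (prod_shift X (rotation_shift alpha alpha)) ->
  (forall j, (1 <= j)%N ->
     minimal (prod_shift X (rotation_shift alpha (beta j)))) ->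
  let Y : set (fullshift bool) := setT in
  let W := prod_shift (prod_shift X Y) Z in
  countable [set: aut W] /\ ~ amenable R (aut W).
Proof.
move=> Z _ _ _ _ _ _ _ _ _ _ minX _ _ _ _ minXZ Y W.
have [[clX X0 XX] _] := minX.
have ZZ j : (1 <= j)%N -> @left_shift bool @` rotation_shift alpha (beta j) =
    rotation_shift alpha (beta j).
  by move=> /minXZ[[_ _ XZ] _]; exact: prod_shift_factor XZ.
have Z0 : Z !=set0.
  (* The product for [j = 1] is nonempty, and the second track of any of its points lies in [Z]. *)
  have [[_ [v [_ Zv]] _] _] := minXZ 1%N isT.
  by exists (fun i => (v i).2); apply: subset_closure; exists 1%N.
split; last exact: aut_full_shift_factor_not_amenable.
apply: aut_countable.
  apply: closed_prod_shift; last exact: closed_closure.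
  by apply: closed_prod_shift => //; exact: closedT.
apply: prod_shift_shift; last exact/closure_shift/bigcup_shift.
apply: prod_shift_shift => //; apply/seteqP; split=> // x _.
exists (fun i => x (i - 1)) => //.
by apply/funext => i; rewrite /left_shift addrK.
Qed.
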